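(* Let $(\mathcal{A}_n)_{n\in\mathbb N}$ be a sequence of unital Banach algebras such that $\mathrm{Asy}(\mathcal{A}_n)$ is Dedekind-finite. Moreover, suppose that one of the following two conditions holds: (1) $\mathcal{A}_n=\mathcal{A}_m$ for every $n,m\in\mathbb N$; (2) $\mathcal{A}_n$ is a $C^*$-algebra for each $n\in\mathbb N$. Then there is $N\in\mathbb N$ such that $\mathcal{A}_n$ is Dedekind-finite for all $n\ge N$.
   Context: Banach algebras are complex and have a contractive product $\|ab\|\le\|a\|\|b\|$; a unital Banach algebra has unit $1$ with $\|1\|=1$. For a sequence $(\mathcal A_n)$ of Banach algebras, $\ell^\infty(\mathcal A_n)$ is the Banach algebra of all bounded sequences $(a_n)$ with $a_n\in\mathcal A_n$, with pointwise operations and the supremum norm; $c_0(\mathcal A_n)$ is the closed two-sided ideal of sequences with $\lim_{n\to\infty}\|a_n\|=0$; and $\mathrm{Asy}(\mathcal A_n)=\ell^\infty(\mathcal A_n)/c_0(\mathcal A_n)$ with the quotient norm. Two idempotents $p,q$ in an algebra $\mathcal A$ are equivalent, $p\sim q$, if there are $a,b\in\mathcal A$ with $p=ab$ and $q=ba$. A unital algebra $\mathcal A$ is Dedekind-finite if every idempotent $p\in\mathcal A$ with $p\sim 1$ satisfies $p=1$ (here idempotents are not required to be self-adjoint, also for $C^*$-algebras). *)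

(* Defs.v *)
From HB Require Import structures.
From mathcomp Require Import all_boot all_order all_algebra.
From mathcomp Require Import all_classical all_reals all_analysis.
From mathcomp Require Import complex.
Set Implicit Arguments.
Unset Strict Implicit.
Unset Printing Implicit Defensive.
Import Order.TTheory GRing.Theory Num.Theory.
Import numFieldNormedType.Exports.
Local Open Scope classical_set_scope.
Local Open Scope ring_scope.

(* HB does not allow joining the library's ring and normed module hierarchies
   above Num.NumDomain, so the multiplication is axiomatized on top of
   CompleteNormedModule and the algType structure is derived from it. The scalar
   field is a parameter [K] here; complex Banach algebras are the instances with
   K := R[i] for R : realType. *)
HB.mixin Record CompleteNormedModule_isUnitalBanachAlgebra (K : numFieldType) A
    of CompleteNormedModule K A := {
  ba_mul : A -> A -> A ;
  ba_one : A ;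
  ba_mulA : associative ba_mul ;
  ba_mul1l : left_id ba_one ba_mul ;
  ba_mul1r : right_id ba_one ba_mul ;
  ba_mulDl : left_distributive ba_mul +%R ;
  ba_mulDr : right_distributive ba_mul +%R ;
  ba_scaleAl : forall (k : K) (x y : A), k *: ba_mul x y = ba_mul (k *: x) y ;
  ba_scaleAr : forall (k : K) (x y : A), k *: ba_mul x y = ba_mul x (k *: y) ;
  ba_normM : forall x y : A, `|ba_mul x y| <= `|x| * `|y| ;
  ba_norm1 : `|ba_one| = 1
}.

#[short(type="unitalBanachAlgType")]
HB.structure Definition UnitalBanachAlgebra (K : numFieldType) :=
  {A of CompleteNormedModule K A
      & CompleteNormedModule_isUnitalBanachAlgebra K A}.

Section banach_algebra_algType.
Variables (K : numFieldType) (A : unitalBanachAlgType K).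

Let one_neq0 : (ba_one : A) != 0.
Proof. by rewrite -normr_eq0 ba_norm1 oner_eq0. Qed.

HB.instance Definition _ :=
  GRing.Zmodule_isNzRing.Build (UnitalBanachAlgebra.sort A)
    ba_mulA ba_mul1l ba_mul1r ba_mulDl ba_mulDr one_neq0.
HB.instance Definition _ :=
  GRing.Lmodule_isLalgebra.Build K (UnitalBanachAlgebra.sort A) ba_scaleAl.
HB.instance Definition _ :=
  GRing.Lalgebra_isAlgebra.Build K (UnitalBanachAlgebra.sort A) ba_scaleAr.

Lemma normM_le (x y : A) : `|x * y| <= `|x| * `|y|.
Proof. exact: ba_normM. Qed.

Lemma norm1 : `|1 : A| = 1.
Proof. exact: ba_norm1. Qed.

End banach_algebra_algType.

(* A C*-algebra is regarded as a Banach algebra that admits an involution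
   satisfying the C*-identity. *)
Definition is_Cstar_algebra (R : realType) (A : unitalBanachAlgType R[i]) :=
  exists star : A -> A,
    [/\ forall x, star (star x) = x,
        forall x y, star (x + y) = star x + star y,
        forall (c : R[i]) x, star (c *: x) = Num.conj c *: star x,
        forall x y, star (x * y) = star y * star x
      & forall x, `|star x * x| = `|x| ^+ 2].

Definition equiv_idempotents (T : pzRingType) (p q : T) :=
  exists a b : T, p = a * b /\ q = b * a.

Definition Dedekind_finite (T : pzRingType) :=
  forall p : T, p * p = p -> equiv_idempotents p 1 -> p = 1.

(* The algebra of all sequences: the library only provides pointwise
   algebraic structures for non-dependent functions. *)
Definition seqs (K : numFieldType) (A : nat -> unitalBanachAlgType K) :=
  forall n, A n.

Section seqs_algebra.
Variables (K : numFieldType) (A : nat -> unitalBanachAlgType K).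
Implicit Types (a b c : seqs A) (k l : K).

HB.instance Definition _ := gen_eqMixin (seqs A).
HB.instance Definition _ := gen_choiceMixin (seqs A).

Let add a b : seqs A := fun n => a n + b n.
Let zero : seqs A := fun=> 0.
Let opp a : seqs A := fun n => - a n.
Let mul a b : seqs A := fun n => a n * b n.
Let one : seqs A := fun=> 1.
Let scale k a : seqs A := fun n => k *: a n.

Let addA : associative add.
Proof. by move=> a b c; apply/functional_extensionality_dep => n; exact: addrA. Qed.

Let addC : commutative add.
Proof. by move=> a b; apply/functional_extensionality_dep => n; exact: addrC. Qed.

Let add0 : left_id zero add.
Proof. by move=> a; apply/functional_extensionality_dep => n; exact: add0r. Qed.

Let addN : left_inverse zero opp add.
Proof. by move=> a; apply/functional_extensionality_dep => n; exact: addNr. Qed.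

HB.instance Definition _ := GRing.isZmodule.Build (seqs A) addA addC add0 addN.

Let mulA : associative mul.
Proof. by move=> a b c; apply/functional_extensionality_dep => n; exact: mulrA. Qed.

Let mul1 : left_id one mul.
Proof. by move=> a; apply/functional_extensionality_dep => n; exact: mul1r. Qed.

Let mulr1 : right_id one mul.
Proof. by move=> a; apply/functional_extensionality_dep => n; exact: mulr1. Qed.

Let mulDl : left_distributive mul +%R.
Proof. by move=> a b c; apply/functional_extensionality_dep => n; exact: mulrDl. Qed.

Let mulDr : right_distributive mul +%R.
Proof. by move=> a b c; apply/functional_extensionality_dep => n; exact: mulrDr. Qed.

Let one_neq0 : one != 0.
Proof.
apply/eqP => e; have /eqP := congr1 (fun a : seqs A => a 0%N) e.
by rewrite oner_eq0.
Qed.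

HB.instance Definition _ := GRing.Zmodule_isNzRing.Build (seqs A)
  mulA mul1 mulr1 mulDl mulDr one_neq0.

Let scaleA k l a : scale k (scale l a) = scale (k * l) a.
Proof. by apply/functional_extensionality_dep => n; exact: scalerA. Qed.

Let scale1 : left_id 1 scale.
Proof. by move=> a; apply/functional_extensionality_dep => n; exact: scale1r. Qed.

Let scaleDr : right_distributive scale +%R.
Proof. by move=> k a b; apply/functional_extensionality_dep => n; exact: scalerDr. Qed.

Let scaleDl a : {morph scale^~ a : k l / k + l}.
Proof. by move=> k l; apply/functional_extensionality_dep => n; exact: scalerDl. Qed.

HB.instance Definition _ := GRing.Zmodule_isLmodule.Build K (seqs A)
  scaleA scale1 scaleDr scaleDl.

Let scaleAl k a b : k *: (a * b) = k *: a * b.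
Proof. by apply/functional_extensionality_dep => n; exact: scalerAl. Qed.

HB.instance Definition _ := GRing.Lmodule_isLalgebra.Build K (seqs A) scaleAl.

Let scaleAr k a b : k *: (a * b) = a * (k *: b).
Proof. by apply/functional_extensionality_dep => n; exact: scalerAr. Qed.

HB.instance Definition _ := GRing.Lalgebra_isAlgebra.Build K (seqs A) scaleAr.

Definition bounded_seq : {pred seqs A} :=
  fun a => `[< exists M : K, forall n, `|a n| <= M >].

Lemma bounded_seq_subalg : GRing.subalg_closed bounded_seq.
Proof.
split.
- by apply/asboolP; exists 1 => n; rewrite norm1.
- move=> k a b /asboolP[M aM] /asboolP[N bN]; apply/asboolP.
  exists (`|k| * M + N) => n.
  rewrite (le_trans (ler_normD _ _))// lerD// normrZ.
  by apply: ler_wpM2l; [exact: normr_ge0|exact: aM].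
- move=> a b /asboolP[M aM] /asboolP[N bN]; apply/asboolP; exists (M * N) => n.
  by rewrite (le_trans (normM_le _ _))// ler_pM.
Qed.

HB.instance Definition _ := GRing.isSubalgClosed.Build K (seqs A) bounded_seq
  bounded_seq_subalg.

End seqs_algebra.

(* l^oo(A_n) as a unital algebra; the supremum norm is not needed to define
   c_0(A_n) and the algebra structure of the quotient. *)
Record linfty (K : numFieldType) (A : nat -> unitalBanachAlgType K) := Linfty {
  linfty_val : seqs A ;
  linfty_valP : linfty_val \in @bounded_seq K A
}.

Section asymptotic_algebra.
Variables (K : numFieldType) (A : nat -> unitalBanachAlgType K).

HB.instance Definition _ := [isSub of linfty A for @linfty_val K A].
HB.instance Definition _ := [Choice of linfty A by <:].
HB.instance Definition _ := [SubChoice_isSubAlgebra of linfty A by <:].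

Definition c0 : {pred linfty A} :=
  fun a => `[< `|linfty_val a n| @[n --> \oo] --> (0 : K^o) >].

Lemma c0P (a : linfty A) :
  reflect (forall e : K, 0 < e -> \forall n \near \oo, `|linfty_val a n| < e)
    (a \in c0).
Proof.
apply: (iffP (asboolP _)) => [/cvgr0Pnorm_lt a0 e /a0|a0].
  by apply: filterS => n; rewrite normr_id.
by apply/cvgr0Pnorm_lt => e /a0; apply: filterS => n; rewrite normr_id.
Qed.

Lemma c0_zmod : zmod_closed c0.
Proof.
split=> [|a b /c0P a0 /c0P b0]; apply/c0P => e e0.
  by near=> n; rewrite normr0.
near=> n; rewrite (le_lt_trans (ler_normB _ _))// (splitr e) ltrD//.
- by near: n; apply: a0; rewrite divr_gt0.
- by near: n; apply: b0; rewrite divr_gt0.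
Unshelve. all: by end_near. Qed.

Lemma c0Ml (a b : linfty A) : b \in c0 -> a * b \in c0.
Proof.
move=> /c0P b0; have /asboolP[M aM] := linfty_valP a.
have M1 : 0 < M + 1.
  by rewrite ltr_wpDl// (le_trans (normr_ge0 _) (aM 0%N)).
apply/c0P => e e0; near=> n.
rewrite (le_lt_trans (normM_le _ _))//.
rewrite (@le_lt_trans _ _ ((M + 1) * `|linfty_val b n|))//.
  by rewrite ler_wpM2r// (le_trans (aM n))// lerDl.
rewrite mulrC -ltr_pdivlMr//.
by near: n; apply: b0; rewrite divr_gt0.
Unshelve. all: by end_near. Qed.

Lemma c0Mr (a b : linfty A) : b \in c0 -> b * a \in c0.
Proof.
move=> /c0P b0; have /asboolP[M aM] := linfty_valP a.
have M1 : 0 < M + 1.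
  by rewrite ltr_wpDl// (le_trans (normr_ge0 _) (aM 0%N)).
apply/c0P => e e0; near=> n.
rewrite (le_lt_trans (normM_le _ _))//.
rewrite (@le_lt_trans _ _ (`|linfty_val b n| * (M + 1)))//.
  by rewrite ler_wpM2l// (le_trans (aM n))// lerDl.
rewrite -ltr_pdivlMr//.
by near: n; apply: b0; rewrite divr_gt0.
Unshelve. all: by end_near. Qed.

Lemma c0_1 : 1 \notin c0.
Proof.
apply/negP => /c0P/(_ 1 ltr01)[N _ /(_ N (leqnn N))] /=.
by rewrite norm1 ltxx.
Qed.

HB.instance Definition _ := GRing.isZmodClosed.Build (linfty A) c0 c0_zmod.

(* The library only makes this quotient a ring when the ambient ring is
   commutative. *)
Definition Asy := Quotient.quot c0.

HB.instance Definition _ := GRing.Zmodule.on Asy.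

Local Open Scope quotient_scope.
Local Notation pi := (\pi_(Quotient.quot c0)).

Let eq_pi (a b : linfty A) : (pi a = pi b) <-> (a - b \in c0).
Proof. by rewrite Quotient.idealrBE; split => [->|/eqP]. Qed.

Let mul : Asy -> Asy -> Asy := lift_op2 Asy *%R.
Let one : Asy := pi 1.
Let scale (k : K) : Asy -> Asy := lift_op1 Asy ( *:%R k).

Let repr_pi (a : linfty A) : repr (pi a) - a \in c0.
Proof. by apply/eq_pi; rewrite reprK. Qed.

Let mul_pi a b : mul (pi a) (pi b) = pi (a * b).
Proof.
rewrite /mul; unlock; apply/eq_pi; set a' := repr _; set b' := repr _.
rewrite (_ : _ - _ = (a' - a) * b' + a * (b' - b)).
  by rewrite rpredD//; [apply/c0Mr|apply/c0Ml]; exact: repr_pi.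
by rewrite mulrBl mulrBr addrA subrK.
Qed.

Let c0Z (k : K) (a : linfty A) : a \in c0 -> k *: a \in c0.
Proof. by move=> ac0; rewrite -[a]mul1r scalerAl c0Ml. Qed.

Let scale_pi k a : scale k (pi a) = pi (k *: a).
Proof. by rewrite /scale; unlock; apply/eq_pi; rewrite -scalerBr c0Z// repr_pi. Qed.

Let addE a b : (pi a : Asy) + (pi b : Asy) = pi (a + b).
Proof. by rewrite -raddfD. Qed.

Let mulA : associative mul.
Proof.
by move=> x y z; rewrite -[x]reprK -[y]reprK -[z]reprK !mul_pi mulrA.
Qed.

Let mul1 : left_id one mul.
Proof. by move=> x; rewrite -[x]reprK mul_pi mul1r. Qed.

Let mulr1 : right_id one mul.
Proof. by move=> x; rewrite -[x]reprK mul_pi mulr1. Qed.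

Let mulDl : left_distributive mul +%R.
Proof.
move=> x y z; rewrite -[x]reprK -[y]reprK -[z]reprK.
by rewrite addE !mul_pi addE mulrDl.
Qed.

Let mulDr : right_distributive mul +%R.
Proof.
move=> x y z; rewrite -[x]reprK -[y]reprK -[z]reprK.
by rewrite addE !mul_pi addE mulrDr.
Qed.

Let one_neq0 : one != 0.
Proof.
apply/eqP => e; have /eq_pi : pi 1 = pi 0 by rewrite -/one e raddf0.
by rewrite subr0 (negPf c0_1).
Qed.

HB.instance Definition _ := GRing.Zmodule_isNzRing.Build Asy
  mulA mul1 mulr1 mulDl mulDr one_neq0.

Let scaleA k l x : scale k (scale l x) = scale (k * l) x.
Proof. by rewrite -[x]reprK !scale_pi scalerA. Qed.

Let scale1 : left_id 1 scale.
Proof. by move=> x; rewrite -[x]reprK scale_pi scale1r. Qed.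

Let scaleDr : right_distributive scale +%R.
Proof.
move=> k x y; rewrite -[x]reprK -[y]reprK.
by rewrite addE !scale_pi addE scalerDr.
Qed.

Let scaleDl x : {morph scale^~ x : k l / k + l}.
Proof. by move=> k l; rewrite -[x]reprK !scale_pi addE scalerDl. Qed.

HB.instance Definition _ := GRing.Zmodule_isLmodule.Build K Asy
  scaleA scale1 scaleDr scaleDl.

Let mulE (x y : Asy) : x * y = mul x y. Proof. by []. Qed.
Let scaleE (k : K) (x : Asy) : k *: x = scale k x. Proof. by []. Qed.

Let scaleAl (k : K) (x y : Asy) : k *: (x * y) = k *: x * y.
Proof.
rewrite -[x]reprK -[y]reprK.
by rewrite !scaleE !mulE mul_pi !scale_pi mul_pi scalerAl.
Qed.

HB.instance Definition _ := GRing.Lmodule_isLalgebra.Build K Asy scaleAl.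

Let scaleAr (k : K) (x y : Asy) : k *: (x * y) = x * (k *: y).
Proof.
rewrite -[x]reprK -[y]reprK.
by rewrite !scaleE !mulE mul_pi !scale_pi mul_pi scalerAr.
Qed.

HB.instance Definition _ := GRing.Lalgebra_isAlgebra.Build K Asy scaleAr.

Definition pi_Asy (a : linfty A) : Asy := pi a.

Lemma pi_Asy_surj (x : Asy) : exists a, x = pi_Asy a.
Proof. by exists (repr x); rewrite /pi_Asy reprK. Qed.

Lemma pi_Asy_eq (a b : linfty A) : pi_Asy a = pi_Asy b <-> a - b \in c0.
Proof. exact: eq_pi. Qed.

Lemma pi_AsyD (a b : linfty A) : pi_Asy (a + b) = pi_Asy a + pi_Asy b.
Proof. by rewrite /pi_Asy addE. Qed.

Lemma pi_AsyZ (k : K) (a : linfty A) : pi_Asy (k *: a) = k *: pi_Asy a.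
Proof. by rewrite /pi_Asy scaleE scale_pi. Qed.

Lemma pi_AsyM (a b : linfty A) : pi_Asy (a * b) = pi_Asy a * pi_Asy b.
Proof. by rewrite /pi_Asy mulE mul_pi. Qed.

Lemma pi_Asy1 : pi_Asy 1 = 1.
Proof. by []. Qed.

End asymptotic_algebra.

(* Main.v *)
(* If [A n] is not Dedekind-finite, there are a, b in [A n] with ba = 1 and
   ab <> 1. If such a, b can be chosen with norms bounded independently of n,
   they define elements of the asymptotic algebra with the same properties in
   which ab - 1 is nonzero, because an idempotent at distance less than 1 from 1
   equals 1. For a constant sequence the bound is clear. In a C*-algebra, a* a
   is self-adjoint and invertible, and a is replaced by a h, where h is
   approximately (a* a)^2 to the power -1/4, obtained from square roots of
   1 - d with ||d|| < 1. Then (a h)* (a h) is close to the sign of a* a, which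
   bounds a h and a left inverse of a h. Working with (a* a)^2 avoids the
   positivity of a* a and all of spectral theory. *)
Require Import Defs.
From mathcomp Require Import all_boot all_order all_algebra.
From mathcomp Require Import all_classical all_reals all_analysis.
From mathcomp Require Import complex ring lra.
Set Implicit Arguments.
Unset Strict Implicit.
Unset Printing Implicit Defensive.
Import Order.TTheory GRing.Theory Num.Theory.
Import numFieldNormedType.Exports.
Local Open Scope classical_set_scope.
Local Open Scope ring_scope.
Local Open Scope complex_scope.

(** * Real-valued norm, completeness and fixed points *)

Section real_norm.
Variables (R : realType) (A : unitalBanachAlgType R[i]).
Implicit Types (x y : A) (k e : R).

(* The norms of the library take values in R[i]; linear arithmetic needs R. *)
Definition nrm x : R := complex.Re `|x|.

Lemma nrmE x : (nrm x)%:C = `|x|.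
Proof. by rewrite RRe_real// normr_real. Qed.

Lemma nrm_ge0 x : 0 <= nrm x.
Proof. by rewrite -lecR nrmE normr_ge0. Qed.

Lemma nrmD x y : nrm (x + y) <= nrm x + nrm y.
Proof. by rewrite -lecR rmorphD/= !nrmE ler_normD. Qed.

Lemma nrmN x : nrm (- x) = nrm x.
Proof. by rewrite /nrm normrN. Qed.

Lemma nrmB x y : nrm (x - y) <= nrm x + nrm y.
Proof. by rewrite -(nrmN y) nrmD. Qed.

Lemma nrm_distC x y : nrm (x - y) = nrm (y - x).
Proof. by rewrite /nrm distrC. Qed.

Lemma nrmM x y : nrm (x * y) <= nrm x * nrm y.
Proof. by rewrite -lecR rmorphM/= !nrmE normM_le. Qed.

Lemma nrm1 : nrm (1 : A) = 1.
Proof. by rewrite /nrm norm1. Qed.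

Lemma nrmZ k x : nrm (k%:C *: x) = `|k| * nrm x.
Proof.
apply: (@complexI R); rewrite rmorphM/= !nrmE normrZ; congr (_ * _).
by rewrite normc_def/= expr0n/= addr0 sqrtr_sqr.
Qed.

Lemma nrmZi x : nrm ('i *: x) = nrm x.
Proof. by rewrite /nrm normrZ normCi mul1r. Qed.

Lemma nrm_le0 x : nrm x <= 0 -> x = 0.
Proof.
move=> x0; apply/eqP; rewrite -normr_eq0 -nrmE.
by rewrite (_ : nrm x = 0) //; apply: le_anti; rewrite x0 nrm_ge0.
Qed.

Lemma nrm_small_eq0 (c : R) x : 0 <= c ->
  (forall e, 0 < e -> nrm x <= c * e) -> x = 0.
Proof.
move=> c0 h; apply: nrm_le0; rewrite leNgt; apply/negP => x0.
have c1 : 0 < 2 * (c + 1) by lra.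
have := h (nrm x / (2 * (c + 1))) (divr_gt0 x0 c1).
rewrite mulrA ler_pdivlMr//; have := mulr_ge0 c0 (ltW x0).
by nra.
Qed.

Definition nrm_closed (S : A -> Prop) :=
  forall x, (forall e, 0 < e -> exists2 y, S y & nrm (x - y) < e) -> S x.

(** Telescoping bounds the tails by a geometric series, so [u] is Cauchy and completeness supplies
    the limit. *)
Lemma nrm_cvg_geometric (u : nat -> A) k c : 0 <= k < 1 ->
  (forall n, nrm (u n.+1 - u n) <= c * k ^+ n) ->
  exists x, forall e, 0 < e ->
    exists N, forall n, (N <= n)%N -> nrm (x - u n) < e.
Proof.
move=> /andP[k0 k1] uk.
have c0 : 0 <= c by have := uk 0%N; rewrite expr0 mulr1; apply/le_trans/nrm_ge0.
have tail n m : (1 - k) * nrm (u (n + m)%N - u n) <= c * k ^+ n * (1 - k ^+ m).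
  elim: m => [|m IH].
    by rewrite addn0 subrr expr0 subrr mulr0 /nrm normr0 /= mulr0.
  have h := uk (n + m)%N.
  have := nrmD (u (n + m).+1 - u (n + m)%N) (u (n + m)%N - u n).
  rewrite addrA subrK addnS exprS => tri.
  have h2 : (1 - k) * nrm (u (n + m).+1 - u (n + m)%N) <=
      (1 - k) * (c * k ^+ (n + m)).
    by rewrite ler_wpM2l// subr_ge0 ltW.
  have h3 := ler_wpM2l (_ : 0 <= 1 - k) tri.
  move: (h3 (ltac:(lra))) h2 IH; rewrite exprD.
  set a := k ^+ n; set b := k ^+ m; nra.
have small e : 0 < e -> exists n, k ^+ n < e.
  move=> e0; have /cvgrPdist_lt/(_ e e0)[N _ /(_ N (leqnn N))] :=
    @cvg_geometric R 1 k (ltac:(by rewrite ger0_norm)).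
  rewrite /= sub0r normrN mul1r ger0_norm ?exprn_ge0// => ?; by exists N.
have cau e : 0 < e -> exists N, forall n, (N <= n)%N -> nrm (u N - u n) < e.
  (* This threshold makes [c * k ^+ N] less than [e * (1 - k)]; the denominator is [c + 1] because
     [c] may be zero. *)
  move=> e0; have [N kN] := small (e * (1 - k) / (c + 1))
    (ltac:(rewrite divr_gt0 ?mulr_gt0//; lra)).
  exists N => n Nn; rewrite nrm_distC.
  have := tail N (n - N)%N; rewrite subnKC// => h.
  have : 0 <= k ^+ (n - N) by exact: exprn_ge0.
  have : 0 <= k ^+ N by exact: exprn_ge0.
  move: kN; rewrite ltr_pdivlMr ?ltr_wpDl//.
  move: h; set a := k ^+ N; set b := k ^+ _; set t := nrm _ => h hN a0 b0.
  have h1 : c * a * (1 - b) <= c * a.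
    by have := mulr_ge0 (mulr_ge0 c0 a0) b0; lra.
  have : (1 - k) * t < (1 - k) * e by lra.
  by rewrite ltr_pM2l// subr_gt0.
have /cauchy_cvgP/cvg_ex[/= x ux] : cauchy (u @ \oo).
  apply/cauchy_exP => e e0.
  have eE : (complex.Re e)%:C = e by rewrite RRe_real// gtr0_real.
  have [|N hN] := cau (complex.Re e); first by rewrite -ltcR eE.
  exists (u N); exists N => // n /= Nn.
  by rewrite -ball_normE /= -nrmE -eE ltcR hN.
exists x => e e0; have /cvgrPdist_lt/(_ e%:C)[|N _ hN] := ux.
  by rewrite ltcR.
by exists N => n Nn; rewrite -ltcR nrmE hN.
Qed.

(** Banach's fixed point theorem on a closed set. The invariant [S] passes to the limit, so the
    fixed point inherits properties such as self-adjointness and commutation. *)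
Lemma contraction_fixpoint (f : A -> A) (S : A -> Prop) k x0 :
  0 <= k < 1 -> nrm_closed S -> S x0 -> (forall x, S x -> S (f x)) ->
  (forall x y, S x -> S y -> nrm (f x - f y) <= k * nrm (x - y)) ->
  exists2 x, S x & f x = x.
Proof.
move=> k01 clS Sx0 fS fk; have /andP[k0 k1] := k01.
pose u n := iter n f x0.
have Su n : S (u n) by elim: n => //= n; exact: fS.
have [x ux] : exists x, forall e, 0 < e ->
    exists N, forall n, (N <= n)%N -> nrm (x - u n) < e.
  apply: (@nrm_cvg_geometric u k (nrm (u 1%N - u 0%N))) => //.
  elim=> [|n IH]; first by rewrite expr0 mulr1.
  apply: le_trans (fk _ _ (Su n.+1) (Su n)) _.
  by rewrite exprS mulrCA ler_wpM2l.
have Sx : S x.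
  by apply: clS => e /ux[N /(_ N (leqnn N))]; exists (u N).
exists x => //; apply/eqP; rewrite -subr_eq0; apply/eqP.
apply: (@nrm_small_eq0 2) => // e e0; have [N uN] := ux e e0.
have := uN N (leqnn N); have := uN N.+1 (leqnSn N).
have := fk _ _ Sx (Su N); have := nrmD (f x - f (u N)) (f (u N) - x).
rewrite addrA subrK (nrm_distC (f (u N)) x) -[f (u N)]/(u N.+1).
by have := nrm_ge0 (x - u N); nra.
Qed.

End real_norm.

(** * Closed conditions and inverses near the unit *)

Section neumann.
Variables (R : realType) (A : unitalBanachAlgType R[i]).
Implicit Types (x y d r : A) (k e : R).

Lemma nrm_closed_ball k : nrm_closed (fun x : A => nrm x <= k).
Proof.
move=> x hx; apply/ler_addgt0Pr => e /hx[y yk xy].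
by have := nrmD (x - y) y; rewrite subrK; lra.
Qed.

Lemma nrm_closed_comm y : nrm_closed (fun x : A => y * x = x * y).
Proof.
move=> x hx; apply/eqP; rewrite -subr_eq0; apply/eqP.
apply: (@nrm_small_eq0 _ _ (2 * nrm y)); first by have := nrm_ge0 y; lra.
move=> e /hx[z yz xz].
have -> : y * x - x * y = y * (x - z) - (x - z) * y.
  by rewrite mulrBr mulrBl yz opprB addrA subrK.
have := nrmB (y * (x - z)) ((x - z) * y).
have := nrmM y (x - z); have := nrmM (x - z) y.
by have := nrm_ge0 y; have := nrm_ge0 (x - z); nra.
Qed.

(** The inverse is the fixed point of [r |-> 1 + d * r]. Iterating among elements that commute with
    [d] makes it two-sided. *)
Lemma neumann d : nrm d < 1 ->
  exists r, (1 - d) * r = 1 /\ r * (1 - d) = 1.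
Proof.
move=> d1.
have [||x xd|x y _ _|r dr fr] := @contraction_fixpoint _ _ (fun r => 1 + d * r)
  (fun x => d * x = x * d) (nrm d) 0 _ (@nrm_closed_comm d).
- by rewrite nrm_ge0.
- by rewrite mulr0 mul0r.
- by rewrite mulrDr mulrDl mulr1 mul1r -!mulrA xd.
- by rewrite opprD addrACA subrr add0r -mulrBr; exact: nrmM.
exists r; rewrite mulrBl mulrBr mul1r mulr1 -dr -[X in X - _]fr.
by rewrite addrK.
Qed.

Lemma scale_invertible k x :
  (exists r, (k%:C *: x) * r = 1 /\ r * (k%:C *: x) = 1) ->
  exists r, x * r = 1 /\ r * x = 1.
Proof.
move=> [r [xr rx]]; exists (k%:C *: r).
by split; [rewrite -scalerAr scalerAl|rewrite -scalerAl scalerAr].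
Qed.

End neumann.

(** * Ring identities for inverses and idempotents *)

Lemma comm_inv (T : pzRingType) (x y z : T) :
  x * y = 1 -> y * x = 1 -> z * x = x * z -> z * y = y * z.
Proof.
move=> xy yx zx.
by rewrite -[LHS]mul1r -yx -mulrA (mulrA x) -zx -mulrA xy mulr1.
Qed.

Lemma idempotent_mul_left_inverse (T : pzRingType) (a b : T) :
  b * a = 1 -> a * b * (a * b) = a * b.
Proof. by move=> ba; rewrite mulrA -(mulrA a) ba mulr1. Qed.

(** Used for an idempotent and its adjoint: [1 - (u - v) ^+ 2] commutes with both, since the two
    products with [u] agree and the square is symmetric in [u] and [v]. *)
Lemma idempotent_diff_sqr (T : pzRingType) (u v : T) :
  u * u = u -> v * v = v ->
  u * (1 - (u - v) * (u - v)) = u * v * u /\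
  (1 - (u - v) * (u - v)) * u = u * v * u.
Proof.
move=> uu vv; split.
  rewrite [LHS]mulrBr mulr1 mulrA [u * (u - v)]mulrBr uu mulrBl !mulrBr uu.
  by rewrite -[u * v * v]mulrA vv [- (u * v * u - _)]opprB addrA subrK subKr.
rewrite [LHS]mulrBl mul1r -[(u - v) * _ * u]mulrA [(u - v) * u]mulrBl uu.
by rewrite mulrBl !mulrBr uu !mulrA vv subrr subr0 subKr.
Qed.

(** * C*-algebras: square roots, inverses and bounded witnesses *)

Section cstar.
Variables (R : realType) (A : unitalBanachAlgType R[i]) (star : A -> A).
Hypothesis starK : forall x, star (star x) = x.
Hypothesis starD : forall x y, star (x + y) = star x + star y.
Hypothesis starZ : forall (c : R[i]) x, star (c *: x) = Num.conj c *: star x.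
Hypothesis starM : forall x y, star (x * y) = star y * star x.
Hypothesis cstar_id : forall x, `|star x * x| = `|x| ^+ 2.
Implicit Types (a b x y d r : A) (k e : R).

Lemma nrm_cstar x : nrm (star x * x) = nrm x ^+ 2.
Proof. by apply: (@complexI R); rewrite rmorphXn/= !nrmE cstar_id. Qed.

Lemma nrm_star x : nrm (star x) = nrm x.
Proof.
have le y : nrm y <= nrm (star y).
  have := nrmM (star y) y; rewrite nrm_cstar.
  have := nrm_ge0 y; have := nrm_ge0 (star y).
  by case: (ltP 0 (nrm y)); nra.
by apply: le_anti; rewrite le -{2}(starK x) le.
Qed.

Lemma star0 : star 0 = 0.
Proof. by apply: (@addrI _ (star 0)); rewrite -starD !addr0. Qed.

Lemma starN x : star (- x) = - star x.
Proof. by apply: (@addrI _ (star x)); rewrite -starD !subrr star0. Qed.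

Lemma starB x y : star (x - y) = star x - star y.
Proof. by rewrite starD starN. Qed.

Lemma star1 : star 1 = 1.
Proof. by rewrite -[LHS]mul1r -{1}(starK 1) -starM mul1r starK. Qed.

Lemma starZr k x : star (k%:C *: x) = k%:C *: star x.
Proof. by rewrite starZ conj_Creal// complex_real. Qed.

Lemma nrm_sqr_selfadj x : star x = x -> nrm (x * x) = nrm x ^+ 2.
Proof. by move=> xs; rewrite -{1}xs nrm_cstar. Qed.

Lemma nrm_closed_selfadj : nrm_closed (fun x => star x = x).
Proof.
move=> x hx; apply/eqP; rewrite -subr_eq0; apply/eqP.
apply: (@nrm_small_eq0 _ _ 2) => // e /hx[y ys xy].
have -> : star x - x = star (x - y) - (x - y).
  by rewrite starB ys opprB addrA subrK.
by have := nrmB (star (x - y)) (x - y); rewrite nrm_star; lra.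
Qed.

(* [r] is the fixed point of the contraction [r |-> (d + r ^+ 2) / 2] of the
   closed ball of radius [k], so that [1 - r] is a square root of [1 - d]. *)
Lemma cstar_sqrt d k : star d = d -> nrm d <= k -> k < 1 ->
  exists r, [/\ star r = r, nrm r <= k, (1 - r) * (1 - r) = 1 - d
    & forall y, y * d = d * y -> y * r = r * y].
Proof.
move=> ds dk k1; have k0 : 0 <= k by apply: le_trans (nrm_ge0 d) dk.
pose f r : A := (2^-1)%:C *: (d + r * r).
pose S (r : A) := [/\ star r = r, nrm r <= k
  & forall y, y * d = d * y -> y * r = r * y].
have half : `|2^-1 : R| = 2^-1 by rewrite ger0_norm// invr_ge0.
have [| | |r [rs rk rc]|x y [xs xk _] [ys yk _]|r [rs rk rc] fr] :=
    @contraction_fixpoint _ _ f S k 0.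
- by rewrite k0.
- move=> x hx; split.
  + by apply: nrm_closed_selfadj => e /hx[y []]; exists y.
  + by apply: nrm_closed_ball => e /hx[y []]; exists y.
  + by move=> y yd; apply: nrm_closed_comm => e /hx[z [_ _ /(_ _ yd)]]; exists z.
- by split; rewrite ?star0 /nrm ?normr0// => y _; rewrite mulr0 mul0r.
- split.
  + by rewrite starZr starD starM rs ds.
  + rewrite nrmZ half; have := nrmD d (r * r); have := nrmM r r.
    by have := nrm_ge0 r; nra.
  + move=> y yd; rewrite -scalerAr -scalerAl mulrDr mulrDl yd.
    by rewrite mulrA (rc _ yd) -mulrA (rc _ yd) mulrA.
- rewrite -scalerBr nrmZ half opprD addrACA subrr add0r.
  have -> : x * x - y * y = x * (x - y) + (x - y) * y.
    by rewrite mulrBr mulrBl addrA subrK.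
  have := nrmD (x * (x - y)) ((x - y) * y).
  have := nrmM x (x - y); have := nrmM (x - y) y.
  by have := nrm_ge0 (x - y); nra.
exists r; split=> //.
rewrite mulrBl mul1r mulrBr mulr1.
have : d + r * r = r + r.
  rewrite -{3 4}fr -scalerDl -rmorphD/=.
  by rewrite (_ : 2^-1 + 2^-1 = 1 :> R) ?scale1r//; lra.
move=> h; have -> : d = r + r - r * r by rewrite -h addrK.
by rewrite !opprB -addrA opprD; congr (1 + _); exact: addrCA.
Qed.

(* [x] is the real part of the unitary [x + i sqrt (1 - x ^+ 2)], whose
   imaginary part is also of norm at most [1]. *)
Lemma nrm_1subsqr x : star x = x -> nrm x < 1 -> nrm (1 - x * x) <= 1.
Proof.
move=> xs x1; have x0 := nrm_ge0 x.
have [|||r [rs rk sq rc]] := @cstar_sqrt (x * x) (nrm x ^+ 2).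
- by rewrite starM xs.
- by rewrite nrm_sqr_selfadj.
- by rewrite expr2; nra.
pose s := 1 - r; have ss : star s = s by rewrite starB star1 rs.
have xr : x * s = s * x by rewrite mulrBr mulrBl mulr1 mul1r rc// mulrA.
pose u := x + 'i *: s.
have us : star u = x - 'i *: s.
  by rewrite starD xs starZ ss conjCi scaleNr.
have u1 : star u * u = 1.
  rewrite us mulrDr !mulrDl !mulNr -!scalerAl -!scalerAr.
  rewrite xr scalerA -(expr2 'i) sqrCi scaleN1r opprK sq.
  by rewrite addrA subrK addrC subrK.
have nu : nrm u = 1.
  have := nrm_cstar u; rewrite u1 nrm1 => /esym/eqP.
  rewrite sqrf_eq1 => /orP[/eqP//|/eqP h]; have := nrm_ge0 u; lra.
have : u - star u = 2%:C *: ('i *: s).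
  rewrite us opprB addrC addrA subrK -[2%R]/(1 + 1 : R).
  by rewrite rmorphD rmorph1 scalerDl scale1r.
move/(congr1 (@nrm R A)); rewrite nrmZ nrmZi ger0_norm// => h.
have := nrmB u (star u); rewrite h nrm_star nu -sq nrm_sqr_selfadj// -/s.
by have := nrm_ge0 s; rewrite expr2; nra.
Qed.

(** Rescaling by [k^-1] reduces this to [nrm_1subsqr]. The bound is a norm form of the positivity of
    [x * x]. *)
Lemma nrm_sqrBsqr x k : 0 < k -> star x = x -> nrm x < k ->
  nrm ((k ^+ 2)%:C *: 1 - x * x) <= k ^+ 2.
Proof.
move=> k0 xs xk; pose y := (k^-1)%:C *: x.
have xE : x = k%:C *: y.
  by rewrite scalerA -rmorphM/= divff ?scale1r// gt_eqF.
have ys : star y = y by rewrite starZr xs.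
have y1 : nrm y < 1.
  by rewrite nrmZ gtr0_norm ?invr_gt0// mulrC ltr_pdivrMr// mul1r.
rewrite xE -scalerAl -scalerAr scalerA -rmorphM -expr2 -scalerBr nrmZ.
rewrite ger0_norm ?sqr_ge0//; have := nrm_1subsqr ys y1.
by have := sqr_ge0 k; nra.
Qed.

(* [l - x] is small relative to [1 + l] because
   [nrm (l - x) ^+ 2 = nrm (l ^+ 2 - x ^+ 2)]. *)
Lemma inv_1addskew x : star x = - x ->
  exists r, (1 + x) * r = 1 /\ r * (1 + x) = 1.
Proof.
move=> xs; have x0 := nrm_ge0 x.
pose l := nrm x ^+ 2; have l0 : 0 <= l by exact: sqr_ge0.
pose d := l%:C *: 1 - x.
have hd : nrm d < 1 + l.
  have : nrm d ^+ 2 <= l ^+ 2 + l.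
    rewrite -nrm_cstar starB starZr star1 xs opprK.
    have -> : (l%:C *: 1 + x) * d = (l ^+ 2)%:C *: 1 - x * x.
      rewrite /d mulrBr !mulrDl -!scalerAl -!scalerAr !mul1r mulr1 scalerA.
      by rewrite -rmorphM/= -expr2 opprD addrA addrK.
    have := nrmB ((l ^+ 2)%:C *: 1) (x * x).
    rewrite nrmZ nrm1 ger0_norm ?sqr_ge0// mulr1 => /le_trans; apply.
    by rewrite lerD2l (le_trans (nrmM _ _)).
  by have := nrm_ge0 d; rewrite !expr2; nra.
have l1 : 0 < 1 + l by lra.
apply: (@scale_invertible _ _ (1 + l)^-1).
(* As [1 + x = (1 + l) - d], division by [1 + l] leaves a perturbation of [1] of norm less than
   1. *)
have -> : ((1 + l)^-1)%:C *: (1 + x) = 1 - ((1 + l)^-1)%:C *: d.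
  have {2}-> : 1 = ((1 + l)^-1)%:C *: ((1 + l)%:C *: (1 : A)).
    by rewrite scalerA -rmorphM/= mulVf ?scale1r// gt_eqF.
  rewrite -scalerBr; congr (_ *: _).
  by rewrite rmorphD/= scalerDl scale1r opprB addrA addrAC addrK addrC.
apply: neumann; rewrite nrmZ gtr0_norm ?invr_gt0//.
by rewrite mulrC ltr_pdivrMr// mul1r.
Qed.

Lemma star_inv x y : star x = x -> x * y = 1 -> y * x = 1 -> star y = y.
Proof.
move=> xs xy yx; rewrite -[LHS]mulr1 -xy mulrA -{1}xs -starM xy.
by rewrite star1 mul1r.
Qed.

(* With [p = a b] and [q = star p], the skew-adjoint element [p - q] makes
   [z = 1 - (p - q) ^+ 2] invertible, and [z] commutes with [p] and [q]. *)
Lemma inv_star_mul a b : b * a = 1 ->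
  exists w, star a * a * w = 1 /\ w * (star a * a) = 1.
Proof.
move=> ba; pose p := a * b; pose q := star p.
have pp : p * p = p by exact: idempotent_mul_left_inverse.
have qq : q * q = q by rewrite /q -starM pp.
have pa : p * a = a by rewrite /p -mulrA ba mulr1.
have bp : b * p = b by rewrite /p mulrA ba mul1r.
have ks : star (p - q) = - (p - q) by rewrite starB starK opprB.
have [r1 [kr1 r1k]] := inv_1addskew ks.
have [|r2 [kr2 r2k]] := @inv_1addskew (- (p - q)).
  by rewrite starN ks.
pose z := (1 - (p - q)) * (1 + (p - q)); pose zi := r1 * r2.
have zzi : z * zi = 1 by rewrite /z /zi mulrA -(mulrA _ _ r1) kr1 mulr1.
have ziz : zi * z = 1 by rewrite /z /zi mulrA -(mulrA r1) r2k mulr1.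
have zE : z = 1 - (p - q) * (p - q).
  rewrite /z; set k := p - q.
  by rewrite mulrBl mul1r mulrDr mulr1 opprD addrA addrK.
have [pz zp] := idempotent_diff_sqr pp qq.
have [qz zq] := idempotent_diff_sqr qq pp.
have sq : (q - p) * (q - p) = (p - q) * (p - q).
  by rewrite -opprB mulNr mulrN opprK.
rewrite sq -zE in qz zq; rewrite -zE in pz zp.
have cp : p * zi = zi * p by apply: comm_inv zzi ziz _; rewrite pz.
have cq : q * zi = zi * q by apply: comm_inv zzi ziz _; rewrite qz.
have [pE qE] : a * b = p /\ star p = q by [].
clearbody z zi q p.
(* On the right, [star a = star a * q] and [q * p * q = q * z] reduce the product to
   [star a * star b = 1]. On the left, [p * q * p = z * p] reduces it to [b * p * a = 1]. *)
exists (b * q * zi * star b); split.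
  have aq : star a * q = star a by rewrite -qE -starM pa.
  have -> : star a * a * (b * q * zi * star b) =
      star a * (q * p * q * zi) * star b.
    by rewrite -{1}aq -pE !mulrA.
  by rewrite -qz -(mulrA q) zzi mulr1 aq -starM ba star1.
have -> : b * q * zi * star b * (star a * a) = b * (zi * (p * q * p)) * a.
  have -> : b * q * zi * star b * (star a * a) = b * (q * zi) * q * a.
    by rewrite -{3}qE -pE starM !mulrA.
  rewrite cq -!mulrA (mulrA q q) qq -[in LHS]bp -{1}pa -!mulrA.
  by rewrite (mulrA p zi) cp -!mulrA.
by rewrite -zp (mulrA zi) ziz mul1r -mulrA pa ba.
Qed.

(* [h] approximates [(x ^+ 2) ^ (-1/4)], so that [h x h] is close to the sign
   of [x]. *)
Lemma approx_sign x v : star x = x -> x * v = 1 -> v * x = 1 ->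
  nrm x <= 2^-1 ->
  exists h t, [/\ star h = h, t * (h * x * h) = 1, nrm (h * x * h) <= 2
    & nrm t <= 2].
Proof.
move=> xs xv vx x2; have v0 := nrm_ge0 v.
have vs := star_inv xs xv vx.
(* [mu] is so small that [eta <= 2 * mu] gives [eta * nrm v ^+ 2 <= 2^-1], while [m = 1 - mu] still
   exceeds [nrm x]. *)
pose mu := (4 * (1 + nrm v ^+ 2))^-1.
have d0 : 0 < 4 * (1 + nrm v ^+ 2) by have := sqr_ge0 (nrm v); lra.
have mu0 : 0 < mu by rewrite invr_gt0.
have muE : mu * (4 * (1 + nrm v ^+ 2)) = 1 by rewrite mulVf// gt_eqF.
have mv0 : 0 <= mu * nrm v ^+ 2 by rewrite mulr_ge0 ?sqr_ge0 ?ltW.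
have mu4 : mu <= 4^-1 by lra.
pose m := 1 - mu; pose eta := 1 - m ^+ 2.
have eta0 : 0 < eta by rewrite /eta /m; nra.
have etav : eta * nrm v ^+ 2 <= 2^-1.
  have : eta <= 2 * mu by rewrite /eta /m; nra.
  by have := sqr_ge0 (nrm v); nra.
pose d : A := (m ^+ 2)%:C *: 1 - x * x.
have ds : star d = d by rewrite starB starZr star1 starM xs.
have dm : nrm d <= m ^+ 2 by apply: nrm_sqrBsqr => //; rewrite /m; lra.
have m1 : m ^+ 2 < 1 by rewrite /eta in eta0; lra.
have dE : 1 - d = eta%:C *: 1 + x * x.
  by rewrite /d opprB addrCA addrC rmorphB rmorph1 scalerBl scale1r.
(* Two successive square roots give [g] with [g ^+ 4 = 1 - d = eta + x ^+ 2]; [h] is its inverse. *)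
have [r1 [r1s r1m sq1 c1]] := cstar_sqrt ds dm m1.
have [r2 [r2s r2m sq2 c2]] := cstar_sqrt r1s r1m m1.
have [h [gh hg]] := neumann (le_lt_trans r2m m1).
set g := 1 - r2 in sq2 gh hg.
have gs : star g = g by rewrite starB star1 r2s.
have hs := star_inv gs gh hg.
have xg : x * g = g * x.
  rewrite mulrBr mulrBl mulr1 mul1r; congr (_ - _); apply/c2/c1.
  by rewrite mulrBr mulrBl -scalerAr -scalerAl mulr1 mul1r mulrA.
have gv : g * v = v * g by apply: comm_inv xv vx _; rewrite xg.
pose t := g * v * g; pose sg := h * x * h.
have tsg : t * sg = 1.
  by rewrite /t /sg !mulrA -(mulrA _ g h) gh mulr1 -(mulrA g) vx mulr1.
have sgt : sg * t = 1.
  by rewrite /t /sg !mulrA -(mulrA _ h g) hg mulr1 -(mulrA h) xv mulr1.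
have sgs : star sg = sg by rewrite !starM hs xs mulrA.
have ts : star t = t by rewrite !starM gs vs mulrA.
(* Since [g] commutes with [v], the square of [t] is [v ^+ 2 * g ^+ 4]. *)
have ttE : t * t = 1 + eta%:C *: (v * v).
  have -> : t * t = v * v * ((g * g) * (g * g)).
    by rewrite /t gv -!mulrA; congr (_ * _); rewrite !mulrA -gv -!mulrA
      (mulrA g v) gv -!mulrA (mulrA g v) gv -!mulrA.
  rewrite sq2 sq1 dE mulrDr -scalerAr mulr1 addrC; congr (_ + _).
  by rewrite mulrA -(mulrA v v) vx mulr1 vx.
have nvv : nrm (eta%:C *: (v * v)) <= 2^-1.
  by rewrite nrmZ gtr0_norm//; have := nrmM v v; rewrite -expr2; nra.
have nsg : nrm (sg * sg) <= 2.
  have sgsg : sg * sg * (t * t) = 1 by rewrite mulrA -(mulrA sg) sgt mulr1.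
  set s := sg * sg in sgsg *; set w := _ *: _ in ttE nvv.
  (* With [nrm w <= 2^-1] this yields [nrm s <= 1 + nrm s / 2]. *)
  have sE : s = 1 - s * w.
    by apply/eqP; rewrite eq_sym subr_eq -{1}[s]mulr1 -mulrDr -ttE sgsg.
  have := nrmB 1 (s * w); rewrite -sE nrm1; have := nrmM s w.
  by have := nrm_ge0 s; nra.
exists h, t; split => //.
- rewrite -/sg; have := nrm_ge0 sg.
  by move: nsg; rewrite (nrm_sqr_selfadj sgs) expr2; nra.
- have : nrm (t * t) <= 1 + 2^-1.
    by rewrite ttE (le_trans (nrmD _ _))// nrm1 lerD2l.
  have := nrm_ge0 t.
  by rewrite (nrm_sqr_selfadj ts) expr2; nra.
Qed.

(** With [h] and [t] from [approx_sign] for [star a * a], the C*-identity bounds [a' = a * h], and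
    [t * star a'] is a bounded left inverse of it. *)
Lemma exists_bounded_left_inverse a b : b * a = 1 -> a * b <> 1 ->
  exists a' b', [/\ nrm a' <= 2, nrm b' <= 4, b' * a' = 1 & a' * b' <> 1].
Proof.
(* Replacing [a] by [c a] and [b] by [b / c] keeps both products and meets the norm hypothesis of
   [approx_sign]. *)
wlog a2 : a b / nrm a ^+ 2 <= 2^-1.
  move=> wl ba ab; pose c := (2 * (1 + nrm a))^-1.
  have n0 := nrm_ge0 a; have c0 : 0 < 2 * (1 + nrm a) by lra.
  have cinv : c * c^-1 = 1 by rewrite divff// invr_eq0 gt_eqF.
  apply: (wl (c%:C *: a) ((c^-1)%:C *: b)).
  - rewrite nrmZ gtr0_norm ?invr_gt0// mulrC.
    have : nrm a * c <= 2^-1 by rewrite ler_pdivrMr//; lra.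
    have : 0 <= nrm a * c by rewrite mulr_ge0// ?invr_ge0 ltW.
    by rewrite expr2; nra.
  - by rewrite -scalerAl -scalerAr scalerA -rmorphM mulrC cinv scale1r.
  - by rewrite -scalerAl -scalerAr scalerA -rmorphM cinv scale1r.
move=> ba ab; have [v [yv vy]] := inv_star_mul ba.
have ys : star (star a * a) = star a * a by rewrite starM starK.
have [|h [t [hs th n2 t2]]] := approx_sign ys yv vy.
  by rewrite nrm_cstar.
pose a' := a * h; have a'a' : star a' * a' = h * (star a * a) * h.
  by rewrite starM hs !mulrA.
have na' : nrm a' <= 2.
  have := nrm_cstar a'; rewrite a'a' => h1.
  by have := nrm_ge0 a'; rewrite h1 expr2 in n2; nra.
exists a', (t * star a'); split => //.
- have := nrmM t (star a'); rewrite nrm_star.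
  by have := nrm_ge0 a'; have := nrm_ge0 t; nra.
- by rewrite -mulrA a'a'.
(* If [a' * b' = 1], then [b = b * a' * b' = h * b'], hence [a * b = a' * b' = 1]. *)
- move=> e; apply: ab; rewrite -[RHS]e /a' -mulrA; congr (_ * _).
  by rewrite -[LHS]mulr1 -e /a' !mulrA ba mul1r.
Qed.

End cstar.

(** * From bounded witnesses to the asymptotic algebra *)

Lemma not_Dedekind_finite (T : pzRingType) : ~ Dedekind_finite T ->
  exists a b : T, b * a = 1 /\ a * b <> 1.
Proof.
apply: contra_notP => h p pp [a [b [pE ba]]]; apply: contrapT => p1.
by apply: h; exists a, b; rewrite -pE.
Qed.

Definition bounded_nonfinite (R : realType) (B : unitalBanachAlgType R[i])
    (C : R) := exists a b : B,
  [/\ nrm a <= C, nrm b <= C, b * a = 1 & a * b <> 1].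

(** The complement [1 - p] is idempotent, so its norm is at most its own square; a norm below 1 must
    then vanish. *)
Lemma idempotent_near1 (R : realType) (B : unitalBanachAlgType R[i]) (p : B) :
  p * p = p -> nrm (p - 1) < 1 -> p = 1.
Proof.
move=> pp n1; apply/eqP; rewrite -subr_eq0; apply/eqP/nrm_le0.
have : (p - 1) * (p - 1) = - (p - 1).
  by rewrite mulrBl mul1r mulrBr pp mulr1 subrr sub0r.
move/(congr1 (@nrm R B)); rewrite nrmN => h.
by have := nrmM (p - 1) (p - 1); have := nrm_ge0 (p - 1); rewrite h; nra.
Qed.

Lemma bounded_nrm (R : realType) (A : nat -> unitalBanachAlgType R[i])
  (a : seqs A) (C : R) : (forall n, nrm (a n) <= C) -> a \in @bounded_seq _ A.
Proof. by move=> aC; apply/asboolP; exists C%:C => n; rewrite -nrmE lecR. Qed.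

Lemma Asy_Dedekind_finite (R : realType) (A : nat -> unitalBanachAlgType R[i])
  (C : R) : (forall n, ~ Dedekind_finite (A n) -> bounded_nonfinite (A n) C) ->
  Dedekind_finite (Asy A) ->
  exists N, forall n, (N <= n)%N -> Dedekind_finite (A n).
Proof.
move=> hC hAsy; pose D := Num.max C 1.
(* At Dedekind-finite indices the default pair is [(1, 1)], which [D >= 1] admits. The last clause
   holds vacuously at the other indices. *)
have ex n : exists ab : A n * A n, [/\ nrm ab.1 <= D, nrm ab.2 <= D,
    ab.2 * ab.1 = 1 & ab.1 * ab.2 = 1 -> Dedekind_finite (A n)].
  have [df|/hC[a [b [aC bC ba ab]]]] := pselect (Dedekind_finite (A n)).
    by exists (1, 1); split; rewrite ?mulr1//= nrm1 le_max lexx orbT.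
  by exists (a, b); split => //=; rewrite le_max ?aC ?bC.
pose s n := projT1 (cid (ex n)).
have sP n : [/\ nrm (s n).1 <= D, nrm (s n).2 <= D, (s n).2 * (s n).1 = 1
    & (s n).1 * (s n).2 = 1 -> Dedekind_finite (A n)] := projT2 (cid (ex n)).
have aD : (fun n => (s n).1) \in @bounded_seq _ A.
  by apply: (@bounded_nrm _ _ _ D) => n; have [] := sP n.
have bD : (fun n => (s n).2) \in @bounded_seq _ A.
  by apply: (@bounded_nrm _ _ _ D) => n; have [] := sP n.
pose a := Linfty aD; pose b := Linfty bD.
have ba : b * a = 1.
  by apply: val_inj; apply: functional_extensionality_dep => n; have [] := sP n.
have piba : pi_Asy b * pi_Asy a = 1 by rewrite -pi_AsyM ba pi_Asy1.
have : pi_Asy (a * b) = pi_Asy 1.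
  rewrite pi_AsyM pi_Asy1; apply: hAsy; last by exists (pi_Asy a), (pi_Asy b).
  exact: idempotent_mul_left_inverse piba.
(* Radius 1 suffices: from [N] on, the idempotent [a n * b n] is within distance less than 1 of the
   unit. *)
move=> /pi_Asy_eq/c0P/(_ 1 ltr01)[N _ hN].
exists N => n Nn; have [_ _ ban] := sP n; apply; apply: idempotent_near1.
  exact: idempotent_mul_left_inverse ban.
by rewrite -ltcR nrmE; exact: hN n Nn.
Qed.

Lemma cstar_bounded_nonfinite (R : realType) (B : unitalBanachAlgType R[i]) :
  is_Cstar_algebra B -> ~ Dedekind_finite B -> bounded_nonfinite B 4.
Proof.
move=> [star [sK sD sZ sM sN]] /not_Dedekind_finite[a [b [ba ab]]].
have [a' [b' [a2 b4 ba' ab']]] :=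
  exists_bounded_left_inverse sK sD sZ sM sN ba ab.
by exists a', b'; split => //; apply: le_trans a2 _; lra.
Qed.

Theorem corollary3p9 (R : realType) (A : nat -> unitalBanachAlgType R[i])
  (hAsy : Dedekind_finite (Asy A))
  (hA : (forall n m : nat, A n = A m) \/
        (forall n : nat, is_Cstar_algebra (A n))) :
  exists N : nat, forall n : nat, leq N n -> Dedekind_finite (A n).
Proof.
case: hA => [Aconst|Astar]; last first.
  by apply: Asy_Dedekind_finite hAsy => n; exact: cstar_bounded_nonfinite.
have [df|/not_Dedekind_finite[a [b [ba ab]]]] :=
  pselect (Dedekind_finite (A 0%N)).
  by exists 0%N => n _; rewrite (Aconst n 0%N).
(* A single pair from [A 0] serves every index, so its norms give the uniform bound. *)
apply: (@Asy_Dedekind_finite _ _ (Num.max (nrm a) (nrm b))) hAsy => n _.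
by rewrite (Aconst n 0%N); exists a, b; split; rewrite ?le_max ?lexx ?orbT.
Qed.
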